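(* Let $D$ be a real $m\times p$ matrix, let $S\subseteq\mathbb{R}^m$ be a closed convex set, and let $T=D^{-1}(S)=\{x\in\mathbb{R}^p: Dx\in S\}$. Suppose the convex function $f:\mathbb{R}^p\to\mathbb{R}$ possesses a unique minimum point $y$ on the closed convex set $T$ (that is, $y\in T$ and $f(y)<f(x)$ for all $x\in T$ with $x\neq y$). Then for all sufficiently large $\rho>0$, the objective $$h_\rho(x)=f(x)+\frac{\rho}{2}\operatorname{dist}(Dx,S)^2$$ is coercive and therefore attains its minimum value on $\mathbb{R}^p$.
   Context: For a nonempty closed set $S$, $\operatorname{dist}(z,S)=\min_{s\in S}\|z-s\|$ is the Euclidean distance. A function $h$ on $\mathbb{R}^p$ is coercive if $h(x)\to\infty$ as $\|x\|\to\infty$. *)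

(* Defs.v *)
From HB Require Import structures.
From mathcomp Require Import all_boot all_order all_algebra.
From mathcomp Require Import all_classical all_reals all_analysis.

Set Implicit Arguments.
Unset Strict Implicit.
Unset Printing Implicit Defensive.

Import Order.TTheory GRing.Theory Num.Theory.
Import numFieldNormedType.Exports.

Local Open Scope classical_set_scope.
Local Open Scope ring_scope.

(* The library norm `|x| on matrices is the sup norm, hence a separate
   Euclidean norm. Both induce the canonical topology on 'cV[R]_n used by
   [closed]. *)
Definition enorm (R : realType) (n : nat) (x : 'cV[R]_n) : R :=
  Num.sqrt (\sum_(i < n) x i 0 ^+ 2).

(* For nonempty closed S the infimum is a minimum: see [dist_attained]. *)
Definition dist (R : realType) (n : nat) (z : 'cV[R]_n) (S : set 'cV[R]_n) : R :=
  inf [set enorm (z - s) | s in S].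

Definition coercive (R : realType) (n : nat) (h : 'cV[R]_n -> R) : Prop :=
  forall A : R, exists B : R, forall x : 'cV[R]_n, B < enorm x -> A < h x.

Definition attains_min (R : realType) (n : nat) (h : 'cV[R]_n -> R) : Prop :=
  exists x : 'cV[R]_n, forall z : 'cV[R]_n, h x <= h z.

Lemma enorm_ge0 (R : realType) (n : nat) (x : 'cV[R]_n) : 0 <= enorm x.
Proof. exact: sqrtr_ge0. Qed.

Lemma norm_coord_le_enorm (R : realType) (n : nat) (x : 'cV[R]_n) (i : 'I_n) :
  `|x i 0| <= enorm x.
Proof.
rewrite -sqrtr_sqr ler_wsqrtr// (bigD1 i)//= lerDl.
by apply: sumr_ge0 => j _; exact: sqr_ge0.
Qed.

Lemma enorm_continuous (R : realType) (n : nat) : continuous (@enorm R n).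
Proof.
move=> x; apply: (@continuous_comp _ _ _
  (fun x : 'cV[R]_n => \sum_(i < n) x i 0 ^+ 2) (@Num.sqrt R)); last first.
  exact: sqrt_continuous.
apply: continuous_big => [|i _ v]; first exact: add_continuous.
apply: (@continuous_comp _ _ _ (fun x : 'cV[R]_n => x i 0) (fun t => t ^+ 2)).
  exact: coord_continuous.
exact: exprn_continuous.
Qed.

Lemma trmx_continuous (R : realType) (m n : nat) :
  continuous (@trmx R m n).
Proof.
move=> M A [P M_P sPA]; exists (fun i j => P j i) => [i j|N PN].
  by have := M_P j i; rewrite mxE.
by apply: sPA => i j; rewrite mxE; exact: PN.
Qed.

Lemma dist_attained (R : realType) (n : nat) (z : 'cV[R]_n)
    (S : set 'cV[R]_n) :
  closed S -> S !=set0 ->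
  exists2 s, S s & dist z S = enorm (z - s) /\
    forall s', S s' -> enorm (z - s) <= enorm (z - s').
Proof.
move=> cS [s0 Ss0].
pose g (v : 'rV[R]_n) := enorm (z - v^T).
have gC : continuous g.
  move=> v; apply: (@continuous_comp _ _ _ (fun v : 'rV[R]_n => z - v^T)).
    by apply: (@cvgB R _ _ (nbhs v)); [exact: cvg_cst|exact: trmx_continuous].
  exact: enorm_continuous.
pose r := enorm z + enorm (z - s0).
pose B := [set v : 'rV[R]_n | forall i, `[- r, r]%classic (v ord0 i)].
have cB : compact B.
  by apply: (@rV_compact _ _ (fun=> `[- r, r]%classic)) => _; exact: segment_compact.
pose K := B `&` (@trmx R 1 n) @^-1` S.
have cK : compact K.
  apply: compact_closedI => //; apply: preimage_closed => // v _.
  exact: trmx_continuous.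
have inK s : S s -> enorm (z - s) <= enorm (z - s0) -> K s^T.
  move=> Ss zs; split; last by rewrite /= trmxK.
  move=> i; rewrite /= in_itv/= -ler_norml mxE.
  have -> : s i ord0 = z i 0 - (z - s) i 0 by rewrite !mxE opprB addrC subrK.
  rewrite (le_trans (ler_normB _ _))// lerD ?norm_coord_le_enorm//.
  by rewrite (le_trans (norm_coord_le_enorm _ _)).
have [|c /set_mem[_ Sc] cmin] := compact_EVT_min _ cK (continuous_subspaceT gC).
  by exists s0^T; exact: inK.
have cle s' : S s' -> enorm (z - c^T) <= enorm (z - s').
  move=> Ss'.
  have c0 : enorm (z - c^T) <= enorm (z - s0).
    by have := cmin _ (mem_set (inK _ Ss0 (lexx _))); rewrite /g trmxK.
  have [h|/ltW h] := leP (enorm (z - s')) (enorm (z - s0)).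
    by have := cmin _ (mem_set (inK _ Ss' h)); rewrite /g trmxK.
  exact: le_trans c0 h.
exists c^T => //; split=> //; apply/eqP; rewrite eq_le; apply/andP; split.
  apply: ge_inf; last by exists c^T.
  by exists 0 => _ [t _ <-]; exact: enorm_ge0.
apply: lb_le_inf; first by exists (enorm (z - s0)), s0.
by move=> _ [t St <-]; exact: cle.
Qed.

(* Main.v *)
(* Since the penalty vanishes at [y], [h rho y = f y] for every [rho]. On the
   compact unit sphere around [y], the points with [f x <= f y] lie outside
   [T] by uniqueness of the minimum, so [dist (D x) S ^+ 2] is bounded below by
   a positive constant there and a large [rho] gives [h rho > f y] on the
   whole sphere. As [h rho] is convex, this strict gap propagates to linear
   growth at infinity. The sphere is taken in the sup norm, which is
   equivalent to the Euclidean one. *)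
Require Import Defs.
From mathcomp Require Import all_boot all_order all_algebra.
From mathcomp Require Import all_classical all_reals all_analysis.
From mathcomp Require Import lra.

Set Implicit Arguments.
Unset Strict Implicit.
Unset Printing Implicit Defensive.

Import Order.TTheory GRing.Theory Num.Theory.
Import numFieldNormedType.Exports.

Local Open Scope classical_set_scope.
Local Open Scope ring_scope.

(** * Convexity inequalities and continuity of convex functions *)

(** Trades the bundled unit-interval coefficient for a real [t] with explicit bounds, a form that
    [lra] can use. *)
Lemma convex_functionTP (R : realType) (E : lmodType R) (f : E -> R) :
  convex_function [set: E] f <->
  forall (t : R) (x z : E), 0 <= t <= 1 ->
    f (t *: x + (1 - t) *: z) <= t * f x + (1 - t) * f z.
Proof.
split=> [fc t x z /andP[t0 t1]|fc t x z _ _]; last first.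
  by apply: fc; rewrite ge0 le1.
by apply: (fc (Itv01 t0 t1)); rewrite in_setT.
Qed.

Lemma convex_midpoint (R : realType) (E : lmodType R) (f : E -> R) (x z : E) :
  convex_function [set: E] f -> f (2^-1 *: x + 2^-1 *: z) <= (f x + f z) / 2.
Proof.
move=> /convex_functionTP/(_ 2^-1 x z).
have -> : 1 - 2^-1 = 2^-1 :> R by lra.
by move=> h; apply: le_trans (h _) _; lra.
Qed.

(** The point [x + s *: e] is a convex combination of [x + e] and [x]. The absolute value makes the
    bound monotone in [s]. *)
Lemma convex_le_segment (R : realType) (E : lmodType R) (f : E -> R) (x e : E)
    (s : R) :
  convex_function [set: E] f -> 0 <= s <= 1 ->
  f (x + s *: e) <= f x + s * `|f (x + e) - f x|.
Proof.
move=> /convex_functionTP fc s01; have /andP[s0 s1] := s01.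
have -> : x + s *: e = s *: (x + e) + (1 - s) *: x.
  by rewrite scalerDr scalerBl scale1r addrAC addrCA subrr addr0 addrC.
apply: le_trans (fc _ _ _ s01) _.
have := ler_wpM2l s0 (ler_norm (f (x + e) - f x)); lra.
Qed.

(* Halving [c e + w] as the midpoint of [2 c e] and [2 w] peels off one
   direction at a time. *)
Lemma convex_locally_le (R : realType) (E : lmodType R) (I : Type) (f : E -> R)
    (x : E) (e : I -> E) (r : seq I) :
  convex_function [set: E] f ->
  exists C d : R, [/\ 0 <= C, 0 < d & forall (c : I -> R) (b : R),
    b <= d -> (forall i, `|c i| <= b) ->
    f (x + \sum_(i <- r) c i *: e i) <= f x + C * b].
Proof.
move=> fc; elim: r => [|i r [C [d [C0 d0 ih]]]].
  exists 0, 1; split=> // c b _ _; rewrite big_nil addr0 mul0r addr0 //.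
(* Both slopes are included because the sign of [c i] decides between the directions [e i] and
   [- e i]. *)
pose Ci := `|f (x + e i) - f x| + `|f (x - e i) - f x|.
have Ci0 : 0 <= Ci by rewrite addr_ge0.
(* Doubling the coefficients requires [2 * b <= d] for the induction hypothesis and [2 * b <= 1] to
   stay on the segment towards [x + e i] or [x - e i]. *)
exists (C + Ci), (Num.min (d / 2) 2^-1); split.
- exact: addr_ge0.
- by rewrite lt_min; apply/andP; split; lra.
- move=> c b; rewrite le_min => /andP[bd b2] cb; rewrite big_cons.
  have b0 : 0 <= b by apply: le_trans (cb i).
  set w := \sum_(j <- r) _.
  have -> : x + (c i *: e i + w) =
      2^-1 *: (x + (2 * c i) *: e i) + 2^-1 *: (x + 2 *: w).
    rewrite !scalerDr !scalerA addrACA -scalerDl mulrA mulVf ?pnatr_eq0//.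
    rewrite mul1r scale1r; congr (_ + _).
    by rewrite (_ : 2^-1 + 2^-1 = 1) ?scale1r//; lra.
  apply: le_trans (convex_midpoint _ _ fc) _.
  have hi : f (x + (2 * c i) *: e i) <= f x + 2 * b * Ci.
    have [ci0|/ltW ci0] := leP 0 (c i).
      have cib : c i <= b by rewrite -(ger0_norm ci0).
      apply: le_trans (convex_le_segment _ _ fc _) _; first by apply/andP; split; lra.
      rewrite lerD2l ler_pM ?mulr_ge0 ?ler_wpM2l//.
      by rewrite lerDl.
    have cib : - c i <= b by rewrite -(ler0_norm ci0).
    have -> : (2 * c i) *: e i = (2 * - c i) *: - e i.
      by rewrite mulrN scalerN scaleNr opprK.
    apply: le_trans (convex_le_segment _ _ fc _) _; first by apply/andP; split; lra.
    rewrite lerD2l ler_pM ?mulr_ge0 ?oppr_ge0 ?ler_wpM2l//.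
    by rewrite lerDr.
  have hw : f (x + 2 *: w) <= f x + C * (2 * b).
    rewrite scaler_sumr; under eq_bigr do rewrite scalerA.
    apply: (ih (fun j => 2 * c j)) => [|j]; first lra.
    by rewrite normrM ger0_norm// ler_wpM2l.
  lra.
Qed.

Lemma norm_coord_le_norm (R : realType) (n : nat) (x : 'cV[R]_n) (i : 'I_n) :
  `|x i 0| <= `|x|.
Proof. by rewrite [leRHS]/Num.norm/= mx_normrE (le_bigmax _ _ (i, 0)). Qed.

(** Near [x] there is a linear upper bound. Since [x] is the midpoint of [x + v] and [x - v], the
    upper bound at [x - v] yields the matching lower bound at [x + v]. *)
Lemma convex_function_continuous (R : realType) (n : nat) (f : 'cV[R]_n -> R) :
  convex_function [set: 'cV[R]_n] f -> continuous f.
Proof.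
move=> fc x.
have [C [d [C0 d0 ub]]] :=
  convex_locally_le x (fun i : 'I_n => delta_mx i 0) (index_enum 'I_n) fc.
have fub v : `|v| <= d -> f (x + v) <= f x + C * `|v|.
  move=> vd; have -> : v = \sum_i v i 0 *: delta_mx i 0.
    rewrite [LHS]matrix_sum_delta; apply: eq_bigr => i _.
    by rewrite big_ord1.
  rewrite -[X in C * `|X|](_ : v = _); last first.
    rewrite [LHS]matrix_sum_delta; apply: eq_bigr => i _.
    by rewrite big_ord1.
  by apply: ub => // i; exact: norm_coord_le_norm.
have flip v : `|v| <= d -> `|f (x + v) - f x| <= C * `|v|.
  move=> vd; have := fub v vd; have := fub (- v); rewrite normrN => /(_ vd).
  have := convex_midpoint (x + v) (x - v) fc.
  rewrite -scalerDr addrACA subrr addr0 scalerDr -scalerDl.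
  rewrite (_ : 2^-1 + 2^-1 = 1) ?scale1r; last lra.
  move=> h1 h2 h3.
  by rewrite ler_norml; apply/andP; split; lra.
apply/(@cvgrPdist_le _ _ _ (nbhs x)) => eps eps0.
(* [C] may vanish, so [eps] is divided by [C + 1]. *)
have C1 : 0 < C + 1 by lra.
near=> z.
have zd : `|z - x| <= d by rewrite distrC; near: z; apply: cvgr_dist_le.
have ze : `|z - x| <= eps / (C + 1).
  by rewrite distrC; near: z; apply: cvgr_dist_le => //; exact: divr_gt0.
have := flip _ zd; rewrite [x + _]addrC subrK distrC => /le_trans; apply.
apply: (@le_trans _ _ ((C + 1) * `|z - x|)); first by rewrite ler_wpM2r// lerDl.
by rewrite mulrC -ler_pdivlMr.
Unshelve. all: by end_near. Qed.

(** * Compactness of column-vector sets and comparison of the two norms *)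

Lemma cV_bounded_closed_compact (R : realType) (n : nat) (A : set 'cV[R]_n) :
  bounded_set A -> closed A -> compact A.
Proof.
move=> [M [Mreal bA]] cA.
(* Continuity of transposition transports compactness from row vectors to columns. *)
have -> : A = @trmx R 1 n @` (@trmx R 1 n @^-1` A).
  apply/seteqP; split => [v Av|_ [w Aw <-]//].
  by exists v^T => /=; rewrite trmxK.
apply: continuous_compact.
  by apply/continuous_subspaceT; exact: trmx_continuous.
apply: bounded_closed_compact; last first.
  by apply: preimage_closed => // v _; exact: trmx_continuous.
exists M; split=> // u Mu v Av; apply: le_trans (bA u Mu _ Av).
rewrite [leLHS]/Num.norm/= mx_normrE; apply/bigmax_leP; split=> // -[i j] _ /=.
by rewrite ord1; have := norm_coord_le_norm v^T j; rewrite mxE.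
Qed.

Lemma norm_le_enorm (R : realType) (n : nat) (x : 'cV[R]_n) : `|x| <= enorm x.
Proof.
rewrite [leLHS]/Num.norm/= mx_normrE; apply/bigmax_leP; split=> [|[i j] _ /=].
  exact: enorm_ge0.
by rewrite ord1; exact: norm_coord_le_enorm.
Qed.

Lemma enorm_le_norm (R : realType) (n : nat) (x : 'cV[R]_n) :
  enorm x <= Num.sqrt n%:R * `|x|.
Proof.
rewrite -[X in _ * X]normr_id -sqrtr_sqr -sqrtrM// ler_wsqrtr//.
rewrite mulr_natl -[X in _ *+ X]card_ord -sumr_const ler_sum// => i _.
by rewrite -[leLHS]real_normK ?num_real// lerXn2r ?nnegrE ?norm_coord_le_norm.
Qed.

Lemma cV_compact_sphere (R : realType) (n : nat) (y : 'cV[R]_n) (r : R) :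
  compact [set x | `|x - y| = r].
Proof.
apply: cV_bounded_closed_compact.
  exists (r + `|y|); split; first exact: num_real.
  move=> M hM x /= xr; rewrite ltW// (le_lt_trans _ hM)// -xr.
  by rewrite -[leLHS]/`|x| -{1}(subrK y x) ler_normD.
apply: (@preimage_closed _ _ (fun x : 'cV[R]_n => `|x - y|) [set t | t = r]);
  last exact: closed_eq.
move=> x _; apply: (@continuous_comp _ _ _ (fun x : 'cV[R]_n => x - y)).
  by apply: (@cvgB R _ _ (nbhs x)); [exact: cvg_id|exact: cvg_cst].
exact: norm_continuous.
Qed.

(** * Coercivity and existence of minimizers *)

Lemma continuous_coercive_attains_min (R : realType) (n : nat)
    (h : 'cV[R]_n -> R) : continuous h -> coercive h -> attains_min h.
Proof.
move=> hc /(_ (h 0)) [B hB].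
(* [B] may be negative; the maximum keeps [0] in [K], so the minimum over [K] is at most [h 0],
   which values outside [K] exceed. *)
pose r := Num.max B (enorm (0 : 'cV[R]_n)).
pose K : set 'cV[R]_n := [set x | enorm x <= r].
have cK : compact K.
  apply: cV_bounded_closed_compact.
    exists r; split; first exact: num_real.
    move=> M rM x /= xr; apply: le_trans (norm_le_enorm x) _.
    by rewrite ltW// (le_lt_trans xr).
  apply: (@preimage_closed _ _ (@enorm R n) [set t | t <= r]);
    last exact: closed_le.
  by move=> x _; exact: enorm_continuous.
have K0 : K 0 by rewrite /K/= le_max lexx orbT.
have [|c _ cmin] := compact_EVT_min _ cK (continuous_subspaceT hc).
  by exists 0.
exists c => z; have [zK|zK] := leP (enorm z) r.
  by apply: cmin; rewrite inE.
apply: le_trans (cmin 0 _) _; first by rewrite inE.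
by apply/ltW/hB; apply: le_lt_trans zK; rewrite le_max lexx.
Qed.

(* Convexity propagates the gap on the unit sphere to linear growth: for
   [|x - y| = t >= 1], the point at distance 1 on the segment [[y, x]] gives
   [h x >= h y + t * gap]. *)
Lemma convex_gt_sphere_coercive (R : realType) (n : nat) (h : 'cV[R]_n -> R)
    (y : 'cV[R]_n) :
  convex_function [set: 'cV[R]_n] h ->
  (forall x, `|x - y| = 1 -> h y < h x) -> coercive h.
Proof.
move=> hconv hy; have hc := convex_function_continuous hconv.
have [e e0 he] : exists2 e, 0 < e & forall x, `|x - y| = 1 -> h y + e <= h x.
  (* The sphere is empty when [n = 0]; any positive gap then works. *)
  have [[x0 x01]|S0] := pselect (exists x, `|x - y| = 1); last first.
    by exists 1 => // x x1; case: S0; exists x.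
  have [|c /set_mem/= c1 cmin] :=
    compact_EVT_min _ (@cV_compact_sphere R n y 1) (continuous_subspaceT hc).
    by exists x0.
  exists (h c - h y) => [|x x1]; first by rewrite subr_gt0 hy.
  by rewrite addrC subrK cmin// inE.
(* With [t] the distance [|x - y|], the first bound puts [t^-1] in the unit interval and the second
   gives [h y + t * e > A]. In the radius, [|y|] passes from [x - y] to [x], and the square root
   from the sup norm to the Euclidean one. *)
move=> A; pose M := Num.max 1 ((A - h y) / e).
exists (Num.sqrt n%:R * (M + `|y|)) => x xB.
have Mt : M < `|x - y|.
  rewrite ltNge; apply/negP => xM; move: xB; apply/negP; rewrite -leNgt.
  apply: le_trans (enorm_le_norm x) _; rewrite ler_wpM2l ?sqrtr_ge0//.
  by rewrite -{1}(subrK y x) (le_trans (ler_normD _ _))// lerD2r.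
move: Mt; rewrite gt_max; set t := `|x - y| => /andP[t1 At].
have t0 : 0 < t by lra.
have ti : 0 <= t^-1 <= 1 by rewrite invr_ge0 (ltW t0) invf_le1// ltW.
pose z := t^-1 *: x + (1 - t^-1) *: y.
have zy : z - y = t^-1 *: (x - y).
  by rewrite /z scalerBl scale1r addrCA addrC addrK -scalerBr.
have z1 : `|z - y| = 1.
  by rewrite zy normrZ ger0_norm ?invr_ge0 ?(ltW t0)// mulVf ?gt_eqF.
have := le_trans (he _ z1) (proj1 (convex_functionTP h) hconv _ x y ti).
move: At; rewrite ltr_pdivrMr// => At.
move=> /(ler_wpM2l (ltW t0)).
rewrite mulrDr mulrDr mulrA mulfV ?gt_eqF// mul1r mulrA mulrBr mulr1.
rewrite mulfV ?gt_eqF//; lra.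
Qed.

(** * Convexity of the squared distance and of the penalized objective *)

Lemma enorm_sqr (R : realType) (n : nat) (x : 'cV[R]_n) :
  enorm x ^+ 2 = \sum_(i < n) x i 0 ^+ 2.
Proof. by rewrite sqr_sqrtr// sumr_ge0// => i _; exact: sqr_ge0. Qed.

Lemma convex_enorm_sqr (R : realType) (n : nat) :
  convex_function [set: 'cV[R]_n] (fun x : 'cV[R]_n => enorm x ^+ 2).
Proof.
apply/convex_functionTP => t x z /andP[t0 t1].
rewrite !enorm_sqr !mulr_sumr -big_split/= ler_sum// => i _; rewrite !mxE.
(* In each coordinate the convexity gap of the square is [t * (1 - t) * (x i 0 - z i 0) ^+ 2]. *)
have := mulr_ge0 (mulr_ge0 t0 _) (sqr_ge0 (x i 0 - z i 0)).
move=> /(_ (1 - t)); rewrite subr_ge0 => /(_ t1); lra.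
Qed.

Lemma dist_eq0 (R : realType) (n : nat) (z : 'cV[R]_n) (S : set 'cV[R]_n) :
  closed S -> S !=set0 -> dist z S = 0 <-> S z.
Proof.
move=> cS S0; have [s Ss [-> smin]] := dist_attained z cS S0.
split=> [zs0|Sz].
  suff -> : z = s by [].
  apply/eqP; rewrite -subr_eq0 -normr_eq0 eq_le normr_ge0 andbT -zs0.
  exact: norm_le_enorm.
apply/eqP; rewrite eq_le enorm_ge0 andbT (le_trans (smin z Sz))//.
by apply: le_trans (enorm_le_norm _) _; rewrite subrr normr0 mulr0.
Qed.

(** The convex combination of the points of [S] nearest to [x] and [z] lies in [S], so it bounds the
    distance from [w]; convexity of the squared norm concludes. *)
Lemma convex_dist_sqr (R : realType) (n : nat) (S : set 'cV[R]_n) :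
  closed S -> S !=set0 -> convex_set S ->
  convex_function [set: 'cV[R]_n] (fun z : 'cV[R]_n => dist z S ^+ 2).
Proof.
move=> cS S0 Sconv; apply/convex_functionTP => t x z t01.
have /andP[t0 t1] := t01.
have [a Sa [-> _]] := dist_attained x cS S0.
have [b Sb [-> _]] := dist_attained z cS S0.
set w := t *: x + _; have [c _ [-> cmin]] := dist_attained w cS S0.
have Sab : S (t *: a + (1 - t) *: b).
  by apply/set_mem; apply: (Sconv _ _ (Itv01 t0 t1)); exact: mem_set.
have := proj1 (convex_functionTP _) (@convex_enorm_sqr R n) t (x - a) (z - b) t01.
apply: le_trans; rewrite lerXn2r ?nnegrE ?enorm_ge0// (le_trans (cmin _ Sab))//.
by rewrite /w !scalerBr opprD addrACA.
Qed.

Lemma convex_penalized (R : realType) (m p : nat) (D : 'M[R]_(m, p))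
    (S : set 'cV[R]_m) (f : 'cV[R]_p -> R) (a : R) :
  0 <= a -> closed S -> S !=set0 -> convex_set S ->
  convex_function [set: 'cV[R]_p] f ->
  convex_function [set: 'cV[R]_p]
    (fun x : 'cV[R]_p => f x + a * dist (D *m x) S ^+ 2).
Proof.
move=> a0 cS S0 Sconv /convex_functionTP fconv.
apply/convex_functionTP => t x z t01.
have := fconv t x z t01; rewrite mulmxDr -!scalemxAr.
have := proj1 (convex_functionTP _) (convex_dist_sqr cS S0 Sconv)
  t (D *m x) (D *m z) t01.
move=> /(ler_wpM2l a0); lra.
Qed.

(** * Threshold for the penalty parameter *)

Theorem proposition3p1 (R : realType) (m p : nat) (D : 'M[R]_(m, p))
    (S : set 'cV[R]_m) (f : 'cV[R]_p -> R) (y : 'cV[R]_p) :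
  let T : set 'cV[R]_p := [set x | S (D *m x)] in
  let h (rho : R) (x : 'cV[R]_p) := f x + rho / 2 * dist (D *m x) S ^+ 2 in
  closed S -> convex_set S ->
  convex_function [set: 'cV[R]_p] f ->
  T y -> (forall x, T x -> x <> y -> f y < f x) ->
  \forall rho \near +oo, coercive (h rho) /\ attains_min (h rho).
Proof.
move=> T h cS Sconv fconv Ty ymin.
have S0 : S !=set0 by exists (D *m y).
have hconv (rho : R) : 0 <= rho -> convex_function [set: 'cV[R]_p] (h rho).
  by move=> rho0; apply: convex_penalized => //; exact: divr_ge0.
have hy rho : h rho y = f y.
  by rewrite /h (proj2 (dist_eq0 (D *m y) cS S0) Ty) expr0n mulr0 addr0.
pose d2 (x : 'cV[R]_p) := dist (D *m x) S ^+ 2.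
have d2_ge0 x : 0 <= d2 x by exact: sqr_ge0.
(* The condition [0 <= r] ensures that [h rho] is convex for every [rho > r]. *)
suff [r [r0 hr]] : exists r, 0 <= r /\ forall rho, r < rho ->
    forall x, `|x - y| = 1 -> f y < h rho x.
  near=> rho.
  have rrho : r < rho by near: rho; apply: nbhs_pinfty_gt; exact: num_real.
  have rho0 : 0 <= rho by rewrite (le_trans r0)// ltW.
  have hco : coercive (h rho).
    apply: (convex_gt_sphere_coercive (y := y)) => [|x x1]; first exact: hconv.
    by rewrite hy; exact: hr.
  split=> //; apply: continuous_coercive_attains_min => //.
  exact/convex_function_continuous/hconv.
have fcont := convex_function_continuous fconv.
have d2cont : continuous d2.
  (* [d2] is the penalized objective of the zero function with weight 1, hence convex and so
     continuous. *)
  have /convex_function_continuous : convex_function [set: 'cV[R]_p]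
      (fun x : 'cV[R]_p => 0 + 1 * dist (D *m x) S ^+ 2).
    apply: convex_penalized => //; apply/convex_functionTP => t x z _.
    by rewrite !mulr0 addr0.
  by rewrite (_ : (fun _ => _) = d2)//; apply/funext => x; rewrite add0r mul1r.
pose K := [set x : 'cV[R]_p | `|x - y| = 1] `&` [set x | f x <= f y].
have cK : compact K.
  apply: compact_closedI; first exact: cV_compact_sphere.
  apply: (@preimage_closed _ _ f [set t | t <= f y]); last exact: closed_le.
  by move=> x _; exact: fcont.
(* If [K] is empty, [f] alone exceeds [f y] on the sphere and the threshold 0 suffices. *)
have [K0|nK] := pselect (K !=set0); last first.
  exists 0; split=> // rho rho0 x x1.
  have fyx : f y < f x by rewrite ltNge; apply/negP => fxy; apply: nK; exists x.
  by apply: lt_le_trans fyx _; rewrite lerDl mulr_ge0 ?divr_ge0 ?sqr_ge0 ?(ltW rho0).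
have [c /set_mem Kc cmin] := compact_EVT_min K0 cK (continuous_subspaceT fcont).
have [d /set_mem Kd dmin] := compact_EVT_min K0 cK (continuous_subspaceT d2cont).
have d2_gt0 : 0 < d2 d.
  rewrite lt_neqAle d2_ge0 andbT eq_sym sqrf_eq0; apply/negP => /eqP dD0.
  have Td : T d by apply/(dist_eq0 _ cS S0).
  case: Kd => /= d1 fd; move: fd; apply/negP; rewrite -ltNge ymin// => dy.
  by move: d1; rewrite dy subrr normr0 => /eqP; rewrite eq_sym oner_eq0.
(* On [K], [f] is at least [f c] and [d2] at least [d2 d], so this is the [rho] solving
   [f c + rho / 2 * d2 d = f y]. *)
exists (2 * (f y - f c) / d2 d); split.
  by rewrite divr_ge0// mulr_ge0// subr_ge0; case: Kc.
move=> rho; rewrite ltr_pdivrMr// => rhod x x1.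
have rho0 : 0 <= rho.
  rewrite -(pmulr_lge0 _ d2_gt0) (le_trans _ (ltW rhod))//.
  by rewrite mulr_ge0// subr_ge0; case: Kc.
have [fxy|fyx] := leP (f x) (f y); last first.
  by apply: lt_le_trans fyx _; rewrite lerDl mulr_ge0 ?divr_ge0 ?sqr_ge0.
have Kx : x \in K by apply: mem_set.
have := cmin x Kx; have := ler_wpM2l rho0 (dmin x Kx).
rewrite /h -/(d2 x); lra.
Unshelve. all: by end_near. Qed.
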